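(* Among target pairs $(H_w,H_r)$ with $b_w\le 2$ one has $L=\mathrm{EC}=\mathrm{FWC}$, and such a pair is realizable if and only if it satisfies dominance and the following all-long bounds: for every $w$-vertex $n$ with $h_n>\rho_1$ and every $0\le m\le b_r$, $$\bar H_w(n-1+m)\ge\frac{n-1}{n}H_w(n)+H_r(m),\qquad\text{and, if }n\ge3,\quad \bar H_w(m+1)\ge\frac1nH_w(n)+H_r(m).$$ For $b_w=2$ the only restriction in addition to dominance is $$h_2>\rho_1\quad\Longrightarrow\quad H_r(b_r)\le\tfrac12 H_w(2);$$ that is, a pair with $b_w=2$ is realizable if and only if it satisfies dominance and this implication.
   Context: Instances and realizability. An instance consists of a finite set $E$ of items with rational values $a_i\ge 0$, positive integer sizes $d_i$, and integer capacities $0\le R<D$, with $d_i\le D$ for every item. Write $G(S)=\sum_{i\in S}a_i$ and $d(S)=\sum_{i\in S}d_i$. For $\alpha\in\{w,r\}$ let $U^\alpha(n)$ be the maximum of $G(S)$ over $n$-element sets $S\subseteq E$ with $d(S)\le D$ (for $\alpha=w$) or $d(S)\le R$ (for $\alpha=r$), with value $-\infty$ if there is none; $U^\alpha(0)=0$. The terminal count is $b_\alpha=\min\operatorname{arg\,max}_n U^\alpha(n)$. The hull is the sequence on $\{0,\dots,b_\alpha\}$ obtained by evaluating at integers the upper concave hull of the points $(n,U^\alpha(n))$, $0\le n\le b_\alpha$. A target pair $(H_w,H_r)$ consists of strictly increasing concave rational sequences $H_\alpha$ on $\{0,\dots,b_\alpha\}$ with $H_\alpha(0)=0$ (the zero sequence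 $(0)$, with $b_\alpha=0$, is allowed). It is realizable if a single instance has terminal counts $b_w,b_r$ and hulls exactly $H_w$ and $H_r$. There is no cardinality cap. Notation. $h_n=H_w(n)-H_w(n-1)$, $\rho_m=H_r(m)-H_r(m-1)$, $\rho_1:=0$ if $b_r=0$; $\bar H_\alpha(k)=H_\alpha(\min\{k,b_\alpha\})$. A positive count $n\le b_\alpha$ is an $\alpha$-vertex if $n=b_\alpha$ or the slopes of $H_\alpha$ immediately before and after $n$ differ; $\mathcal V_\alpha$ is the set of $\alpha$-vertices and $N^*=\sum_{n\in\mathcal V_w}n+\sum_{m\in\mathcal V_r}m$. Dominance means $H_r(k)\le\bar H_w(k)$ for $0\le k\le b_r$. Linear closure $L$: the set of target pairs satisfying dominance and, for all $0\le m\le b_r$: at each $w$-vertex $n$ with $h_n>\rho_1$, $\bar H_w(n-1+m)\ge\frac{n-1}{n}H_w(n)+H_r(m)$ and, if $n\ge3$, $\bar H_w(m+1)\ge\frac1nH_w(n)+H_r(m)$; and at each $w$-vertex $n\ge3$ with $\bar H_r(2)<H_w(n)-(n-2)H_w(1)$, $\bar H_w(m+1)\ge H_r(m)+\min\{H_w(n)/n,(H_w(n)-\rho_1)/(n-1)\}$. $\mathrm{EC}$ (exchange closure): the set of target pairs for which dominance holds and there is an admissible witness, consisting of: for each $w$-vertex $n$, an $n$-element labeled set $X_n$ with rational values $x_{n,i}$, a long/short label for each member, and a downward-closed family $\mathcal F_n$ of subsets of $X_n$ containing $\varnothing$ and whose singletons are precisely the short members; for each $r$-vertex $m$, an $m$-element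 set $Z_m$ with rational values $z_{m,j}$; for each such $(n,m)$, a subset $O_{n,m}\subseteq X_n$ with $O_{n,m}\in\mathcal F_n$ and a map $\pi_{n,m}:O_{n,m}\to Z_m$; such that: (EC1) $0\le x_{n,i}\le H_w(1)$, short values are at most $\rho_1$, $\sum_i x_{n,i}=H_w(n)$; every $S\subseteq X_n$ has total value at most $\bar H_w(|S|)$, and every $S\in\mathcal F_n$ has total value at most $\bar H_r(|S|)$. (EC2) $0\le z_{m,j}\le\rho_1$, $\sum_j z_{m,j}=H_r(m)$, and every $S\subseteq Z_m$ has total value at most $\bar H_r(|S|)$. (EC3) $\pi_{n,m}$ is injective, $O_{n,m}$ contains only short members, and $x_{n,i}=z_{m,\pi_{n,m}(i)}$ for $i\in O_{n,m}$. (EC4) For every $(n,m)$ and every long $i\in X_n$, with $k=|O_{n,m}|$, $\bar H_w(n-1+m-k)\ge H_w(n)-x_{n,i}+H_r(m)-\sum_{i'\in O_{n,m}}z_{m,\pi_{n,m}(i')}$. (EC5) For every $(n,m)$, every two-element subset $\{i,i'\}\subseteq X_n$ with $\{i,i'\}\notin\mathcal F_n$, and every $y\in X_n\setminus(\{i,i'\}\cup O_{n,m})$, $\bar H_w(m+1)\ge x_{n,y}+H_r(m)$. If $b_r=0$ the conditions quantifying over $m$ are vacuous. $\mathrm{FWC}$ (full-witness closure): the set of target pairs possessing a full witness, i.e. a ground set $E$ of at most $N^*$ items, nonnegative rational values $a_i$, positive rational sizes $d_i$, rational $0\le R<D$, and subsets $X_n$ ($n\in\mathcal V_w$), $Z_m$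 ($m\in\mathcal V_r$) of $E$ with $|X_n|=n$, $G(X_n)=H_w(n)$, $d(X_n)\le D$, $|Z_m|=m$, $G(Z_m)=H_r(m)$, $d(Z_m)\le R$, such that every $S\subseteq E$ with $d(S)\le D$ has $G(S)\le\bar H_w(|S|)$ and every $S\subseteq E$ with $d(S)\le R$ has $G(S)\le\bar H_r(|S|)$. *)

(* Defs.v *)
From mathcomp Require Import all_boot all_order all_algebra.
From mathcomp Require Import constructive_ereal.

Set Implicit Arguments.
Unset Strict Implicit.
Unset Printing Implicit Defensive.

Import Order.TTheory GRing.Theory Num.Theory.

Local Open Scope ring_scope.

Definition total_value (E : finType) (a : E -> rat) (S : {set E}) : rat :=
  \sum_(i in S) a i.

Record instance := Instance {
  item : finType;
  value : item -> rat;
  isize : item -> nat;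
  capR : nat;
  capD : nat;
  value_ge0 : forall i, 0 <= value i;
  isize_gt0 : forall i, (0 < isize i)%N;
  isize_le : forall i, (isize i <= capD)%N;
  capRD : (capR < capD)%N
}.

Definition total_size (I : instance) (S : {set item I}) : nat :=
  (\sum_(i in S) isize i)%N.

(* [best I c] is U^w for c = capD I and U^r for c = capR I. *)
Definition best (I : instance) (c n : nat) : \bar rat :=
  \big[maxe/-oo%E]_(S : {set item I} | (#|S| == n) && (total_size S <= c)%N)
     ((total_value (@value I) S)%:E)%E.

Definition is_argmax (U : nat -> \bar rat) (n : nat) : Prop :=
  forall m, (U m <= U n)%E.

Definition is_terminal_count (U : nat -> \bar rat) (b : nat) : Prop :=
  is_argmax U b /\ forall n, is_argmax U n -> (b <= n)%N.

(* (k, y) is a convex combination of the points (i, U i), 0 <= i <= b.  In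
   [\bar rat] one has 0 * -oo = 0, so a point with U i = -oo can only carry
   weight 0. *)
Definition in_conv (U : nat -> \bar rat) (b k : nat) (y : rat) : Prop :=
  exists t : 'I_b.+1 -> rat,
    [/\ forall i, 0 <= t i, \sum_i t i = 1, \sum_i t i * i%:R = k%:R
      & (\sum_i (t i)%:E * U i = y%:E)%E].

Definition is_hull (U : nat -> \bar rat) (b : nat) (H : nat -> rat) : Prop :=
  forall k, (k <= b)%N ->
    in_conv U b k (H k) /\ forall y, in_conv U b k y -> y <= H k.

(* A sequence on {0, ..., last_count}; the values of [hval] beyond [last_count]
   are irrelevant. *)
Record target_seq := TargetSeq {
  last_count : nat;
  hval :> nat -> rat;
  hval0 : hval 0 = 0;
  hval_incr : forall n, (n < last_count)%N -> hval n < hval n.+1;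
  hval_concave : forall n, (0 < n < last_count)%N ->
    hval n.+1 - hval n <= hval n - hval n.-1
}.

Definition realizable (Hw Hr : target_seq) : Prop :=
  exists I : instance,
    [/\ is_terminal_count (best I (capD I)) (last_count Hw),
        is_terminal_count (best I (capR I)) (last_count Hr),
        is_hull (best I (capD I)) (last_count Hw) Hw
      & is_hull (best I (capR I)) (last_count Hr) Hr].

(* h_n for H_w and rho_n for H_r, meaningful for 1 <= n <= last_count H *)
Definition slope (H : target_seq) (n : nat) : rat := H n - H n.-1.

Definition rho1 (Hr : target_seq) : rat :=
  if last_count Hr == 0%N then 0 else slope Hr 1.

Definition bar (H : target_seq) (k : nat) : rat := H (minn k (last_count H)).

Definition vertex (H : target_seq) (n : nat) : bool :=
  (0 < n <= last_count H)%N &&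
  ((n == last_count H) || (slope H n != slope H n.+1)).

Definition Nstar (Hw Hr : target_seq) : nat :=
  (\sum_(1 <= n < (last_count Hw).+1 | vertex Hw n) n +
   \sum_(1 <= m < (last_count Hr).+1 | vertex Hr m) m)%N.

Definition dominance (Hw Hr : target_seq) : Prop :=
  forall k, (k <= last_count Hr)%N -> Hr k <= bar Hw k.

Definition all_long_bounds (Hw Hr : target_seq) : Prop :=
  forall n m, vertex Hw n -> slope Hw n > rho1 Hr -> (m <= last_count Hr)%N ->
    bar Hw (n.-1 + m) >= n.-1%:R / n%:R * Hw n + Hr m /\
    ((3 <= n)%N -> bar Hw m.+1 >= n%:R^-1 * Hw n + Hr m).

Definition linear_closure (Hw Hr : target_seq) : Prop :=
  [/\ dominance Hw Hr,
      all_long_bounds Hw Hr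
    & forall n m, vertex Hw n -> (3 <= n)%N ->
        bar Hr 2 < Hw n - (n - 2)%:R * Hw 1%N -> (m <= last_count Hr)%N ->
        bar Hw m.+1 >=
          Hr m + Num.min (Hw n / n%:R) ((Hw n - rho1 Hr) / n.-1%:R)].

(* X_n and Z_m are labeled by 'I_n and 'I_m.  The data are indexed by all
   natural numbers, but are only constrained at vertices. *)
Record exchange_data := ExchangeData {
  xval : forall n, 'I_n -> rat;
  long : forall n, {set 'I_n};
  fam : forall n, {set {set 'I_n}};
  zval : forall m, 'I_m -> rat;
  overlap : forall n m : nat, {set 'I_n};
  pi : forall n m, {i : 'I_n | i \in overlap n m} -> 'I_m
}.

Definition EC_family (W : exchange_data) (n : nat) : Prop :=
  [/\ forall S T : {set 'I_n}, T \in fam W n -> S \subset T -> S \in fam W n,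
      set0 \in fam W n
    & forall i, ([set i] \in fam W n) = (i \notin long W n)].

Definition EC1 (Hw Hr : target_seq) (W : exchange_data) (n : nat) : Prop :=
  [/\ forall i : 'I_n, 0 <= xval W i <= Hw 1%N,
      forall i : 'I_n, i \notin long W n -> xval W i <= rho1 Hr,
      \sum_(i < n) xval W i = Hw n,
      forall S : {set 'I_n}, total_value (@xval W n) S <= bar Hw #|S|
    & forall S : {set 'I_n}, S \in fam W n ->
        total_value (@xval W n) S <= bar Hr #|S|].

Definition EC2 (Hr : target_seq) (W : exchange_data) (m : nat) : Prop :=
  [/\ forall j : 'I_m, 0 <= zval W j <= rho1 Hr,
      \sum_(j < m) zval W j = Hr m
    & forall S : {set 'I_m}, total_value (@zval W m) S <= bar Hr #|S|].

Definition EC3 (W : exchange_data) (n m : nat) : Prop :=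
  [/\ injective (@pi W n m),
      forall i, i \in overlap W n m -> i \notin long W n
    & forall u : {i | i \in overlap W n m}, xval W (val u) = zval W (pi u)].

(* The truncated subtraction is exact: by EC3, a long i is not in the overlap,
   so k <= n - 1. *)
Definition EC4 (Hw Hr : target_seq) (W : exchange_data) (n m : nat) : Prop :=
  forall i : 'I_n, i \in long W n ->
    bar Hw (n.-1 + m - #|overlap W n m|) >=
      Hw n - xval W i + Hr m
      - \sum_(u : {i' | i' \in overlap W n m}) zval W (pi u).

Definition EC5 (Hw Hr : target_seq) (W : exchange_data) (n m : nat) : Prop :=
  forall i i' y : 'I_n, i != i' -> [set i; i'] \notin fam W n ->
    y \notin [set i; i'] :|: overlap W n m ->
    bar Hw m.+1 >= xval W y + Hr m.

Definition admissible (Hw Hr : target_seq) (W : exchange_data) : Prop :=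
  [/\ forall n, vertex Hw n -> EC_family W n /\ EC1 Hw Hr W n,
      forall m, vertex Hr m -> EC2 Hr W m
    & forall n m, vertex Hw n -> vertex Hr m ->
        [/\ overlap W n m \in fam W n, EC3 W n m, EC4 Hw Hr W n m
          & EC5 Hw Hr W n m]].

Definition exchange_closure (Hw Hr : target_seq) : Prop :=
  dominance Hw Hr /\ exists W : exchange_data, admissible Hw Hr W.

Definition full_witness_closure (Hw Hr : target_seq) : Prop :=
  exists (E : finType) (a d : E -> rat) (R D : rat) (X Z : nat -> {set E}),
    [/\ (#|E| <= Nstar Hw Hr)%N,
        (forall i, 0 <= a i) /\ (forall i, 0 < d i),
        0 <= R < D,
        (forall n, vertex Hw n ->
          [/\ #|X n| = n, total_value a (X n) = Hw n & total_value d (X n) <= D]) /\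
        (forall m, vertex Hr m ->
          [/\ #|Z m| = m, total_value a (Z m) = Hr m & total_value d (Z m) <= R])
      & (forall S : {set E}, total_value d S <= D ->
          total_value a S <= bar Hw #|S|) /\
        (forall S : {set E}, total_value d S <= R ->
          total_value a S <= bar Hr #|S|)].

(* Main.v *)
Require Import Defs.
From mathcomp Require Import all_boot all_order all_algebra.
From mathcomp Require Import constructive_ereal lra zify.

Set Implicit Arguments.
Unset Strict Implicit.
Unset Printing Implicit Defensive.

Import Order.TTheory GRing.Theory Num.Theory.

Local Open Scope ring_scope.

(** Write dominance and the all-long bounds as the target condition. For a
    terminal count at most two the linear closure is that condition by
    definition, its last clause being about vertices [n >= 3], and the theorem
    is a circle through it.

    Necessity holds because every kind of witness yields exchange data. In a
    realizing instance the hull value at a vertex is attained by a feasible set: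
    some line through that vertex lies strictly above all other points
    ([vertex_strict_tangent]), so a missing point there could not be made up for
    by convex combinations ([hull_attains_vertex]). Optimal sets at the vertices,
    whether they come from an instance or from a full witness, give exchange data
    by labelling their members and calling an item long when it exceeds the small
    capacity; the exchange inequalities hold since removing a long item, or two
    items that do not fit together in the small capacity, makes room for a whole
    optimal set of the small capacity ([witness_exchange]). Dominance at the
    vertices of [Hr] extends to all counts by concavity
    ([dominance_from_vertices]). For two counts the exchange inequalities give the
    half bound ([exchange_half_bound]): if the second slope of [Hw] exceeds
    [rho1 Hr], both members of the optimal pair are long, and the less valuable
    one, worth at most [Hw 2 / 2], can be replaced to bound [Hr].

    Sufficiency is one explicit integer instance ([sharp_instance_exists]). Unit
    items with the increments of [Hr] as values fill the small capacity, and, if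
    1 is a vertex, an item worth [Hw 1] fills the large one. To reach [Hw 2] there
    are two cases. If the second slope exceeds [rho1 Hr], then [Hr] is at most
    [Hw 2 / 2], and two items of this value that fill the large capacity together
    will do. Otherwise one item worth [Hw 2 - rho1 Hr], hence at most [Hw 1], is
    completed by the most valuable unit item, with room for no second one. The
    optima of this instance are equal to the prescribed values at every count up
    to the terminal ones, not only at the vertices, and its number of items is
    within [Nstar]; so it serves both as a realization and as a full witness. *)

(** * Concave sequences *)

Definition concave_seq (f : nat -> rat) : Prop :=
  forall k, f k.+2 - f k.+1 <= f k.+1 - f k.

Lemma concave_slopes f k j : concave_seq f -> (k <= j)%N ->
  f j.+1 - f j <= f k.+1 - f k.
Proof.
move=> cf /subnK <-; elim: (j - k)%N => [|l IH]; first by rewrite add0n.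
by rewrite addSn; apply: le_trans (cf _) IH.
Qed.

Lemma concave_tangent f k i : concave_seq f ->
  f i <= f k + (f k.+1 - f k) * (i%:R - k%:R).
Proof.
move=> cf; have [le_ki | /ltnW le_ik] := leqP k i.
  rewrite -(subnK le_ki); elim: (i - k)%N => [|l IH].
    by rewrite add0n subrr mulr0 addr0.
  have := concave_slopes cf (leq_addl l k).
  by rewrite addSn -natr1; lra.
rewrite -(subnK le_ik); elim: (k - i)%N => [|l IH].
  by rewrite add0n subrr mulr0 addr0.
have := cf (l + i)%N; have := concave_slopes cf (leq_addl l i).
move=> h1 h2; rewrite addSn -natr1.
have : (f (l + i).+2 - f (l + i).+1 - (f (l + i).+1 - f (l + i)%N))
   * (i%:R - (l + i)%:R - 1) >= 0.
  apply: mulr_le0; first by lra.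
  by rewrite natrD; have := ler0n rat l; lra.
by lra.
Qed.

(** The supporting line from the left; it meets the graph at [k.+1], so that at
    a break point it differs from the one of [concave_tangent]. *)
Lemma concave_tangent_left f k i : concave_seq f ->
  f i <= f k.+1 + (f k.+1 - f k) * (i%:R - k.+1%:R).
Proof. by move=> /(concave_tangent k i); rewrite -natr1; lra. Qed.

Section Bar.
Variable H : target_seq.

Lemma bar_id k : (k <= last_count H)%N -> bar H k = H k.
Proof. by rewrite /bar => /minn_idPl ->. Qed.

Lemma bar_last k : (last_count H <= k)%N -> bar H k = H (last_count H).
Proof. by rewrite /bar => /minn_idPr ->. Qed.

Lemma bar0 : bar H 0 = 0.
Proof. by rewrite /bar min0n hval0. Qed.

Lemma bar_leS k : bar H k <= bar H k.+1.
Proof.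
have [lt_kb | le_bk] := ltnP k (last_count H).
  by rewrite !bar_id ?(ltnW lt_kb) //; apply/ltW/hval_incr.
by rewrite !bar_last // ltnW.
Qed.

Lemma bar_le i j : (i <= j)%N -> bar H i <= bar H j.
Proof.
move=> /subnK <-; elim: (j - i)%N => [|l IH]; first by rewrite add0n.
by rewrite addSn; apply: le_trans IH (bar_leS _).
Qed.

Lemma bar_ge0 k : 0 <= bar H k.
Proof. by rewrite -bar0; apply: bar_le. Qed.

Lemma bar_le_last k : bar H k <= H (last_count H).
Proof.
have [le_kb | /ltnW le_bk] := leqP k (last_count H); last by rewrite bar_last.
by rewrite -[leRHS]bar_id //; apply: bar_le.
Qed.

Lemma bar_concave : concave_seq (bar H).
Proof.
move=> k; have [lt_kb | le_bk] := ltnP k.+1 (last_count H).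
  rewrite !bar_id ?(ltnW lt_kb) // 1?ltnW 1?ltnW //.
  exact: (@hval_concave H k.+1).
by rewrite bar_last ?(leqW le_bk) // -(bar_last le_bk) subrr subr_ge0 bar_leS.
Qed.

Lemma bar1 : bar H 1 = rho1 H.
Proof.
rewrite /rho1 /slope; case: posnP => [b0 | b_gt0].
  by rewrite bar_last ?b0 // hval0.
by rewrite hval0 subr0 bar_id.
Qed.

Lemma vertex_le n : vertex H n -> (n <= last_count H)%N.
Proof. by case/andP=> /andP[]. Qed.

Lemma vertex_gt0 n : vertex H n -> (0 < n)%N.
Proof. by case/andP=> /andP[]. Qed.

Lemma vertex_last : (0 < last_count H)%N -> vertex H (last_count H).
Proof. by rewrite /vertex eqxx leqnn => ->. Qed.

(** The last count is no exception: the sequence increases up to it, and its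
    prolongation turns constant there. *)
Lemma vertex_break k : vertex H k.+1 ->
  bar H k.+2 - bar H k.+1 < bar H k.+1 - bar H k.
Proof.
case/andP => /= le_kb; case: eqP => [def_b _ | /eqP ne_b /= brk].
  rewrite [bar H k.+2]bar_last -?def_b // [bar H k.+1]bar_id // subrr subr_gt0.
  by rewrite bar_id ?(ltnW le_kb) //; apply: hval_incr.
have lt_kb : (k.+1 < last_count H)%N by rewrite ltn_neqAle ne_b.
have := bar_concave k; rewrite le_eqVlt => /predU1P[eq_s | //].
move: brk eq_s; rewrite /slope /= !bar_id ?(ltnW le_kb) // => /eqP + eq_s.
by rewrite eq_s.
Qed.

Lemma nonvertex_affine k : (k.+1 < last_count H)%N -> ~~ vertex H k.+1 ->
  H k.+2 - H k.+1 = H k.+1 - H k.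
Proof.
move=> lt_kb; rewrite /vertex (ltnW lt_kb) /= (ltn_eqF lt_kb) /= negbK.
by rewrite /slope /= eq_sym => /eqP.
Qed.

(** The left and right supporting lines at a vertex have different slopes, and a
    line strictly between them touches the graph nowhere else. *)
Lemma vertex_strict_tangent n : vertex H n -> exists s : rat,
  forall i, i != n -> bar H i < bar H n + s * (i%:R - n%:R).
Proof.
case: n => [/vertex_gt0 // | k vk].
set s1 := bar H k.+1 - bar H k; set s2 := bar H k.+2 - bar H k.+1.
have lt_s : s2 < s1 := vertex_break vk.
exists ((s1 + s2) / 2%:R) => i; rewrite neq_ltn => /orP[lt_ik | lt_ki].
  apply: le_lt_trans (concave_tangent_left k i bar_concave) _.
  by rewrite ltrD2l -/s1 ltr_nM2r ?subr_lt0 ?ltr_nat //; lra.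
apply: le_lt_trans (concave_tangent k.+1 i bar_concave) _.
by rewrite ltrD2l -/s2 ltr_pM2r ?subr_gt0 ?ltr_nat //; lra.
Qed.

End Bar.

(** If the comparison held at all vertices of [Hr] but failed at some [k], then
    the gap would go on shrinking from the first failure up to the last count,
    because [Hr] is affine there while [bar Hw] stays concave; but the last
    count is a vertex. *)
Lemma dominance_from_vertices Hw Hr :
  (forall m, vertex Hr m -> Hr m <= bar Hw m) -> dominance Hw Hr.
Proof.
move=> dom_v; set b := last_count Hr.
have no_drop l k : (k + l).+1 = b -> bar Hw k.+1 < Hr k.+1 ->
    bar Hw k.+1 - Hr k.+1 < bar Hw k - Hr k -> False.
  elim: l k => [|l IH] k def_b lt_k drop.
    have vk : vertex Hr k.+1 by rewrite -(addn0 k) def_b vertex_last // -/b -def_b.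
    by have := dom_v _ vk; lra.
  have lt_kb : (k.+1 < b)%N by rewrite -def_b; lia.
  have nvk : ~~ vertex Hr k.+1 by apply/negP => /dom_v; lra.
  have := nonvertex_affine lt_kb nvk; have := bar_concave Hw k.
  by move=> h1 h2; apply: (IH k.+1); [lia | lra | lra].
elim=> [|k IH] le_kb; first by rewrite hval0 bar0.
rewrite leNgt; apply/negP => lt_k.
have := IH (ltnW le_kb) => h.
by apply: (@no_drop (b - k.+1)%N k) => //; [move: le_kb; rewrite -/b; lia | lra].
Qed.

(** * Optimal values and their concave hulls *)

Section Hulls.
Implicit Types (U : nat -> \bar rat) (b k : nat) (y p s : rat).

Lemma in_conv_point U b k y : (k <= b)%N -> U k = y%:E -> in_conv U b k y.
Proof.
move=> le_kb Uk; pose k0 : 'I_b.+1 := Ordinal (le_kb : (k < b.+1)%N).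
exists (fun i => (i == k0)%:R); split=> [i | | |].
- exact: ler0n.
- by rewrite (bigD1 k0) //= eqxx big1 ?addr0 // => i /negPf ->.
- rewrite (bigD1 k0) //= eqxx mul1r big1 ?addr0 // => i /negPf ->.
  by rewrite mul0r.
- rewrite (bigD1 k0) //= eqxx Uk mul1e big1 ?adde0 // => i /negPf ->.
  by rewrite mul0e.
Qed.

Lemma in_conv_below_line U b k y p s : in_conv U b k y ->
  (forall i, (i <= b)%N -> (U i <= (p + s * (i%:R - k%:R))%:E)%E) -> y <= p.
Proof.
case=> t [t_ge0 t1 tk tU] below; rewrite -lee_fin -tU.
have -> : p = \sum_i t i * (p + s * (i%:R - k%:R)).
  under eq_bigr do rewrite mulrDr mulrCA mulrBr.
  rewrite big_split /= -mulr_suml t1 mul1r -mulr_sumr sumrB tk -mulr_suml t1.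
  by rewrite mul1r subrr mulr0 addr0.
rewrite -sumEFin; apply: lee_sum => i _.
by rewrite EFinM lee_wpmul2l ?lee_fin // below // -ltnS.
Qed.

(** Finitely many strict inequalities leave a common positive margin, by which
    the line can be lowered. *)
Lemma in_conv_strictly_below_line U b k y p s : in_conv U b k y ->
  (forall i, (i <= b)%N -> (U i < (p + s * (i%:R - k%:R))%:E)%E) -> y < p.
Proof.
move=> conv_y below.
have [e e_gt0 margin] : exists2 e : rat, 0 < e &
    forall i, (i <= b)%N -> (U i <= (p - e + s * (i%:R - k%:R))%:E)%E.
  elim: b {conv_y} below => [|b IH] below.
    have := below 0%N isT; case def_U: (U 0%N) => [r| |] // lt_r.
      exists (p + s * (0%:R - k%:R) - r); first by rewrite subr_gt0.
      by case=> // _; rewrite def_U lee_fin; lra.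
    by exists 1 => // -[] // _; rewrite def_U leNye.
  have [e e0 IHe] := IH (fun i le_ib => below i (leqW le_ib)).
  have := below b.+1 (leqnn _); case def_U: (U b.+1) => [r| |] // lt_r.
    exists (Num.min e (p + s * (b.+1%:R - k%:R) - r)).
      by rewrite lt_min e0 subr_gt0.
    move=> i; rewrite leq_eqVlt => /predU1P[-> | /IHe le_i].
      rewrite def_U lee_fin.
      have : Num.min e (p + s * (b.+1%:R - k%:R) - r)
             <= p + s * (b.+1%:R - k%:R) - r by rewrite ge_min lexx orbT.
      lra.
    apply: le_trans le_i _; rewrite lee_fin lerD2r lerD2l lerN2.
    by rewrite ge_min lexx.
  exists e => // i; rewrite leq_eqVlt => /predU1P[-> | /IHe //].
  by rewrite def_U leNye.
suff : y <= p - e by lra.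
exact: in_conv_below_line conv_y margin.
Qed.

End Hulls.

Section Optima.
Variables (I : instance) (c : nat).
Implicit Types S : {set item I}.

Lemma best_ge S : (total_size S <= c)%N ->
  ((total_value (@value I) S)%:E <= best I c #|S|)%E.
Proof.
move=> fitS; rewrite /best.
by apply: (bigmax_sup S); rewrite ?eqxx.
Qed.

Lemma best_le n y :
    (forall S, #|S| = n -> (total_size S <= c)%N ->
      total_value (@value I) S <= y) ->
  (best I c n <= y%:E)%E.
Proof.
move=> le_y; apply/bigmax_leP; split=> [|S /andP[/eqP cardS fitS]].
  exact: leNye.
by rewrite lee_fin le_y.
Qed.

Lemma best_attained n y : (y%:E <= best I c n)%E -> exists S,
  [/\ #|S| = n, (total_size S <= c)%N & y <= total_value (@value I) S].
Proof.
move=> y_le.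
have [/existsP[S /and3P[/eqP cardS fitS le_y]] | none] := boolP
    [exists S : {set item I},
    [&& #|S| == n, (total_size S <= c)%N & y <= total_value (@value I) S]].
  by exists S.
suff : (best I c n < y%:E)%E by rewrite ltNge y_le.
apply/bigmax_ltP; split=> [|S /andP[cardS fitS]]; first exact: ltNyr.
rewrite lte_fin ltNge; apply: contra none => le_y.
by apply/existsP; exists S; rewrite cardS fitS.
Qed.

Lemma best_lt_pinfty n : (best I c n < +oo)%E.
Proof.
by apply/bigmax_ltP; split=> [|S _]; [by [] | exact: ltry].
Qed.

Definition bounded (H : target_seq) : Prop := forall S,
  (total_size S <= c)%N -> total_value (@value I) S <= bar H #|S|.

Definition attains (H : target_seq) (n : nat) : Prop := exists S,
  [/\ #|S| = n, (total_size S <= c)%N & total_value (@value I) S = H n].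

Variable H : target_seq.
Let b := last_count H.

Lemma hull_best_le n :
  is_terminal_count (best I c) b -> is_hull (best I c) b H ->
  (best I c n <= (bar H n)%:E)%E.
Proof.
move=> [term _] hullH.
have in_range k : (k <= b)%N -> (best I c k <= (H k)%:E)%E.
  move=> le_kb; have [_ maxH] := hullH k le_kb.
  case def_U: (best I c k) => [r| |]; last exact: leNye.
    by rewrite lee_fin; apply: maxH; apply: in_conv_point.
  by have := best_lt_pinfty k; rewrite def_U.
have [le_nb | /ltnW le_bn] := leqP n b; first by rewrite bar_id // in_range.
by rewrite bar_last //; apply: le_trans (term n) (in_range _ _).
Qed.

Lemma hull_bounded :
  is_terminal_count (best I c) b -> is_hull (best I c) b H -> bounded H.
Proof.
move=> term hullH S fitS; rewrite -lee_fin.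
exact: le_trans (best_ge fitS) (hull_best_le _ _ _).
Qed.

(** A hull value at a vertex is the value of a feasible set: otherwise all
    points would lie strictly below a supporting line through that vertex, and
    so would their convex combinations. *)
Lemma hull_attains_vertex n :
  is_terminal_count (best I c) b -> is_hull (best I c) b H ->
  vertex H n -> attains H n.
Proof.
move=> term hullH vn; have le_nb := vertex_le vn.
have [s line_s] := vertex_strict_tangent vn; rewrite bar_id // in line_s.
have [convH _] := hullH n le_nb.
have [Hn_le | lt_Hn] := leP (H n)%:E (best I c n).
  have [S [cardS fitS ge_H]] := best_attained Hn_le.
  exists S; split=> //; apply/eqP; rewrite eq_le ge_H andbT.
  by rewrite -(bar_id le_nb) -cardS (hull_bounded term hullH).
suff : H n < H n by rewrite ltxx.
apply: (in_conv_strictly_below_line (s := s) convH) => i _.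
have [-> | ne_in] := eqVneq i n; first by rewrite subrr mulr0 addr0.
by apply: le_lt_trans (hull_best_le i term hullH) _; rewrite lte_fin line_s.
Qed.

Hypotheses (boundedH : bounded H)
           (attainsH : forall n, (n <= b)%N -> attains H n).

Lemma best_le_bar n : (best I c n <= (bar H n)%:E)%E.
Proof. by apply: best_le => S <-; apply: boundedH. Qed.

Lemma best_sharp n : (n <= b)%N -> best I c n = (H n)%:E.
Proof.
move=> le_nb; apply/le_anti; rewrite -{1}(bar_id le_nb) best_le_bar /=.
by have [S [<- fitS <-]] := attainsH le_nb; apply: best_ge.
Qed.

Lemma sharp_terminal_count : is_terminal_count (best I c) b.
Proof.
split=> [m | n argmax_n].
  rewrite (best_sharp (leqnn b)); apply: le_trans (best_le_bar m) _.
  by rewrite lee_fin bar_le_last.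
rewrite leqNgt; apply/negP => lt_nb.
have := argmax_n n.+1; rewrite !best_sharp // 1?ltnW // lee_fin.
by rewrite leNgt hval_incr.
Qed.

Lemma sharp_hull : is_hull (best I c) b H.
Proof.
move=> k le_kb; split=> [|y conv_y].
  by apply: in_conv_point; rewrite ?best_sharp.
apply: (in_conv_below_line (s := bar H k.+1 - bar H k) conv_y) => i _.
apply: le_trans (best_le_bar i) _; rewrite lee_fin -(bar_id le_kb).
exact: concave_tangent (bar_concave H).
Qed.

End Optima.

(** * Exchange data carried by an instance *)

Section Total.
Variables (E : finType) (f : E -> rat).
Implicit Types A B : {set E}.

Lemma totalUI A B :
  total_value f (A :|: B) + total_value f (A :&: B) =
  total_value f A + total_value f B.
Proof.
rewrite /total_value !(big_mkcond (fun i => i \in _)) -!big_split /=.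
apply: eq_bigr => i _; rewrite !inE.
by case: (i \in A); case: (i \in B); rewrite ?addr0 ?add0r.
Qed.

Lemma total_set1 i : total_value f [set i] = f i.
Proof. exact: big_set1. Qed.

Hypothesis f_ge0 : forall i, 0 <= f i.

Lemma total_ge0 A : 0 <= total_value f A.
Proof. exact: sumr_ge0. Qed.

Lemma total_leU A B :
  total_value f (A :|: B) <= total_value f A + total_value f B.
Proof. by rewrite -totalUI lerDl total_ge0. Qed.

Lemma total_sub A B : A \subset B -> total_value f A <= total_value f B.
Proof.
move=> /subsetP sAB; rewrite /total_value [leRHS](bigID (mem A)) /=.
rewrite [X in X + _](eq_bigl (mem A)) ?lerDl ?sumr_ge0 // => i.
by apply/andP/idP => [[] | iA] //; rewrite sAB.
Qed.

Lemma total_mem A i : i \in A -> f i <= total_value f A.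
Proof. by rewrite -sub1set => /total_sub; rewrite total_set1. Qed.

End Total.

Section Label.
Variables (E : finType) (e0 : E).

Definition label (A : {set E}) n (i : 'I_n) : E := nth e0 (enum A) i.

Variables (A : {set E}) (n : nat).
Hypothesis cardA : #|A| = n.

Lemma label_in (i : 'I_n) : label A i \in A.
Proof. by rewrite -mem_enum mem_nth // -cardE cardA. Qed.

Lemma label_inj : injective (@label A n).
Proof.
move=> i j /eqP; rewrite nth_uniq ?enum_uniq -?cardE ?cardA // => /eqP.
exact: val_inj.
Qed.

Lemma label_index x : x \in A -> exists i : 'I_n, label A i = x.
Proof.
rewrite -mem_enum => xA; have lt_x := xA; rewrite -index_mem -cardE cardA in lt_x.
by exists (Ordinal lt_x); rewrite /label /= nth_index.
Qed.

Lemma index_label x : (index x (enum A) < n)%N = (x \in A).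
Proof. by rewrite -cardA cardE index_mem mem_enum. Qed.

Lemma card_label (S : {set 'I_n}) : #|@label A n @: S| = #|S|.
Proof. exact: card_imset label_inj. Qed.

Lemma total_label f (S : {set 'I_n}) :
  total_value f (@label A n @: S) = \sum_(i in S) f (label A i).
Proof. by rewrite /total_value big_imset // => i j _ _; apply: label_inj. Qed.

Lemma label_sub (S : {set 'I_n}) : @label A n @: S \subset A.
Proof. by apply/subsetP => _ /imsetP[i _ ->]; apply: label_in. Qed.

Lemma label_setT : @label A n @: setT = A.
Proof.
apply/eqP; rewrite eqEsubset label_sub; apply/subsetP => x /label_index[i <-].
exact: imset_f.
Qed.

End Label.

(** Full witnesses of any number of items, so that arbitrary instances and the
    full-witness closure can be treated together. *)
Definition witness (Hw Hr : target_seq) (E : finType) (a d : E -> rat)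
    (R D : rat) (X Z : nat -> {set E}) : Prop :=
  [/\ (forall i, 0 <= a i) /\ (forall i, 0 < d i),
      0 <= R < D,
      (forall n, vertex Hw n ->
        [/\ #|X n| = n, total_value a (X n) = Hw n & total_value d (X n) <= D]) /\
      (forall m, vertex Hr m ->
        [/\ #|Z m| = m, total_value a (Z m) = Hr m & total_value d (Z m) <= R])
    & (forall S : {set E}, total_value d S <= D ->
        total_value a S <= bar Hw #|S|) /\
      (forall S : {set E}, total_value d S <= R ->
        total_value a S <= bar Hr #|S|)].

Section ExchangeData.
Variables (E : finType) (e0 : E) (a d : E -> rat) (R : rat).
Variables X Z : nat -> {set E}.

Definition shared n m : {set 'I_n} :=
  [set i | (index (label e0 (X n) i) (enum (Z m)) < m)%N].

Lemma shared_index n m (u : {i : 'I_n | i \in shared n m}) :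
  (index (label e0 (X n) (val u)) (enum (Z m)) < m)%N.
Proof. by have := valP u; rewrite inE. Qed.

(** Exchange data are an abstraction of this situation: the items themselves are
    forgotten, except for their values, for which sets fit in the small capacity
    [R], and for which members two optimal sets share. *)
Definition exchange_of : exchange_data :=
  @ExchangeData (fun n i => a (label e0 (X n) i))
    (fun n => [set i | R < d (label e0 (X n) i)])
    (fun n => [set S : {set 'I_n} | \sum_(i in S) d (label e0 (X n) i) <= R])
    (fun m j => a (label e0 (Z m) j))
    shared
    (fun n m u => Ordinal (shared_index u)).

Variables (Hw Hr : target_seq) (D : rat).
Hypothesis wit : witness Hw Hr a d R D X Z.

Let d_ge0 i : 0 <= d i.
Proof. by case: wit => -[_ d_gt0] _ _ _; apply/ltW/d_gt0. Qed.

Lemma witness_dominance : dominance Hw Hr.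
Proof.
case: wit => _ /andP[_ ltRD] [_ Zopt] [ubD _].
apply: dominance_from_vertices => m /Zopt[cardZ <- fitZ].
rewrite -[in leRHS]cardZ.
by apply: ubD; apply: le_trans fitZ (ltW ltRD).
Qed.

Lemma exchange_of_family n : EC_family exchange_of n.
Proof.
case: wit => _ /andP[R_ge0 _] _ _.
split=> [S T | | i] /=; rewrite ?inE.
- move=> fitT sST; apply: le_trans fitT.
  exact: (@total_sub _ (fun i => d (label e0 (X n) i))).
- by rewrite big_set0.
- by rewrite big_set1 leNgt.
Qed.

Lemma exchange_of_EC1 n : vertex Hw n -> EC1 Hw Hr exchange_of n.
Proof.
move=> vn; case: wit => -[a_ge0 _] _ [Xopt _] [ubD ubR].
have [cardX valX fitX] := Xopt n vn.
have fit_sub (A : {set E}) : A \subset X n -> total_value a A <= bar Hw #|A|.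
  by move=> sA; apply: ubD; apply: le_trans fitX; apply: total_sub.
split=> /= [i | i | | S | S].
- rewrite a_ge0 /= -(bar_id (leq_trans (vertex_gt0 vn) (vertex_le vn))).
  rewrite -(cards1 (label e0 (X n) i)) -[leLHS](total_set1 a).
  by apply: fit_sub; rewrite sub1set label_in.
- rewrite inE -leNgt -bar1 -(cards1 (label e0 (X n) i)).
  by rewrite -total_set1 -[a _]total_set1; apply: ubR.
- rewrite -valX -[in RHS](label_setT e0 cardX) total_label //.
  by apply: eq_bigl => i; rewrite inE.
- rewrite -(card_label e0 cardX) /total_value -total_label //.
  exact/fit_sub/label_sub.
- rewrite inE -(card_label e0 cardX) /total_value -!total_label //.
  exact: ubR.
Qed.

Lemma exchange_of_EC2 m : vertex Hr m -> EC2 Hr exchange_of m.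
Proof.
move=> vm; case: wit => -[a_ge0 _] _ [_ Zopt] [_ ubR].
have [cardZ valZ fitZ] := Zopt m vm.
have fit_sub (A : {set E}) : A \subset Z m -> total_value a A <= bar Hr #|A|.
  by move=> sA; apply: ubR; apply: le_trans fitZ; apply: total_sub.
split=> /= [j | | S].
- rewrite a_ge0 /= -bar1.
  rewrite -(cards1 (label e0 (Z m) j)) -[leLHS](total_set1 a).
  by apply: fit_sub; rewrite sub1set label_in.
- rewrite -valZ -[in RHS](label_setT e0 cardZ) total_label //.
  by apply: eq_bigl => i; rewrite inE.
- rewrite -(card_label e0 cardZ) /total_value -total_label //.
  exact/fit_sub/label_sub.
Qed.

Section Pair.
Variables n m : nat.
Hypotheses (vn : vertex Hw n) (vm : vertex Hr m).

Lemma shared_mem i : (i \in shared n m) = (label e0 (X n) i \in Z m).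
Proof.
case: wit => _ _ [_ /(_ m vm)[cardZ _ _]] _.
by rewrite inE index_label.
Qed.

Lemma label_shared : @label E e0 (X n) n @: shared n m = X n :&: Z m.
Proof.
case: wit => _ _ [/(_ n vn)[cardX _ _] _] _.
apply/setP=> x; rewrite inE; apply/imsetP/andP=> [[i] | [/(label_index e0 cardX)]].
  by rewrite shared_mem => iO ->; rewrite label_in.
by case=> i <- iZ; exists i; rewrite ?shared_mem.
Qed.

Lemma label_pi (u : {i | i \in overlap exchange_of n m}) :
  label e0 (Z m) (@Defs.pi exchange_of n m u) = label e0 (X n) (val u).
Proof. by rewrite /label nth_index // mem_enum -shared_mem (valP u). Qed.

Lemma short_of_mem (i : 'I_n) :
  label e0 (X n) i \in Z m -> d (label e0 (X n) i) <= R.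
Proof.
case: wit => _ _ [_ /(_ m vm)[_ _ fitZ]] _ iZ.
exact: le_trans (total_mem d_ge0 iZ) fitZ.
Qed.

Lemma exchange_of_overlap : overlap exchange_of n m \in fam exchange_of n.
Proof.
case: wit => _ _ [/(_ n vn)[cardX _ _] /(_ m vm)[_ _ fitZ]] _.
rewrite inE -total_label //= label_shared.
exact: le_trans (total_sub d_ge0 (subsetIr _ _)) fitZ.
Qed.

Lemma exchange_of_EC3 : EC3 exchange_of n m.
Proof.
case: wit => _ _ [/(_ n vn)[cardX _ _] _] _.
split=> [u v eq_uv | i | u] /=.
- apply/val_inj/(label_inj (e0 := e0) cardX).
  by rewrite -!label_pi eq_uv.
- by rewrite shared_mem inE -leNgt; apply: short_of_mem.
- by rewrite label_pi.
Qed.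

(** Trading a long member of [X n] for all of [Z m] frees more than the small
    capacity, hence stays feasible for the large one. *)
Lemma exchange_of_EC4 : EC4 Hw Hr exchange_of n m.
Proof.
move=> i; rewrite inE => long_i.
case: wit => _ _ [/(_ n vn)[cardX valX fitX] /(_ m vm)[cardZ valZ fitZ]] [ubD _].
set x := label e0 (X n) i in long_i; set B := X n :\ x.
have xX : x \in X n by apply: label_in.
have BI : B :&: Z m = X n :&: Z m.
  apply/setP=> y; rewrite !inE; case: eqVneq => //= ->.
  apply/esym/negbTE; apply: contraL long_i => /andP[_ /short_of_mem].
  by rewrite -leNgt.
have totB f : total_value f B = total_value f (X n) - f x.
  by rewrite /total_value [in RHS](big_setD1 x) //= addrAC subrr add0r.
have cardB : #|B| = n.-1 by rewrite cardsDS ?sub1set // cards1 cardX subn1.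
have overlap_sum :
    \sum_(u : {i' | i' \in overlap exchange_of n m}) zval exchange_of (Defs.pi u)
    = total_value a (X n :&: Z m).
  rewrite -label_shared total_label // (big_sub (shared n m)) /=.
  by apply: eq_bigr => u _; rewrite label_pi.
rewrite overlap_sum -valX -valZ -totB -(totalUI a B) BI addrK.
have -> : (n.-1 + m - #|overlap exchange_of n m|)%N = #|B :|: Z m|.
  rewrite -(card_label e0 cardX) label_shared -BI -cardB -[in X in (_ + X)%N]cardZ.
  by rewrite -cardsUI addnK.
apply: ubD; apply: le_trans (total_leU d_ge0 _ _) _; rewrite totB; lra.
Qed.

(** Two members of [X n] that do not fit together in the small capacity make
    room for all of [Z m] next to any third member. *)
Lemma exchange_of_EC5 : EC5 Hw Hr exchange_of n m.
Proof.
move=> i i' y ne_ii; rewrite inE -ltNge => big_ii.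
case: wit => _ _ [/(_ n vn)[cardX valX fitX] /(_ m vm)[cardZ valZ fitZ]] [ubD _].
rewrite inE negb_or shared_mem => /andP[y_ii yZ].
have fit3 : d (label e0 (X n) y) + \sum_(j in [set i; i']) d (label e0 (X n) j)
            <= total_value d (X n).
  rewrite -big_setU1 //= -total_label //.
  by apply: total_sub => //; apply: label_sub.
rewrite -valZ -[in leRHS]cardZ; set x := label e0 (X n) y in yZ fit3 *.
have -> : #|Z m|.+1 = #|x |: Z m| by rewrite cardsU1 yZ.
have totU f : f x + total_value f (Z m) = total_value f (x |: Z m).
  by rewrite /total_value big_setU1.
by rewrite totU; apply: ubD; rewrite -totU; lra.
Qed.

End Pair.
End ExchangeData.

Lemma witness_exchange Hw Hr (E : finType) (a d : E -> rat) R D X Z :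
  witness Hw Hr a d R D X Z -> exchange_closure Hw Hr.
Proof.
move=> wit; split; first exact: witness_dominance wit.
have [e0 _ | E0] := pickP (pred_of_simpl (@predT E)).
  exists (exchange_of e0 a d R X Z); split=> [n vn | m vm | n m vn vm].
  - split; last exact: exchange_of_EC1 wit n vn.
    exact: exchange_of_family wit n.
  - exact: exchange_of_EC2 wit m vm.
  - split; first exact: exchange_of_overlap wit _ _ vn vm.
    + exact: exchange_of_EC3 wit _ _ vn vm.
    + exact: exchange_of_EC4 wit _ _ vn vm.
    + exact: exchange_of_EC5 wit _ _ vn vm.
(* Without items there are no vertices, and any data will do. *)
have no_set (A : {set E}) n : (0 < n)%N -> #|A| = n -> False.
  move=> n_gt0 cardA; move: n_gt0; rewrite -cardA => /card_gt0P[x _].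
  by have := E0 x.
case: wit => _ _ [Xopt Zopt] _.
pose none (n : nat) : {set unit} := set0.
exists (exchange_of tt (fun=> 0) (fun=> 0) 0 none none).
have novw n : vertex Hw n -> False.
  by move=> vn; have [cardX _ _] := Xopt n vn; apply: no_set (vertex_gt0 vn) cardX.
split=> [n /novw | m vm | n m /novw] //.
by have [cardZ _ _] := Zopt m vm; case: (no_set _ _ (vertex_gt0 vm) cardZ).
Qed.

(** * Instances as witnesses *)

Section InstanceWitness.
Variable I : instance.

Definition pick_optimal (c : nat) (H : target_seq) (n : nat) : {set item I} :=
  odflt set0 [pick S : {set item I} | [&& #|S| == n, (total_size S <= c)%N
                & total_value (@value I) S == H n]].

Lemma pick_optimalP c H n : attains I c H n ->
  [/\ #|pick_optimal c H n| = n, (total_size (pick_optimal c H n) <= c)%N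
    & total_value (@value I) (pick_optimal c H n) = H n].
Proof.
case=> S [cardS fitS valS]; rewrite /pick_optimal; case: pickP => [T | none] /=.
  by case/and3P => /eqP-> -> /eqP.
by have := none S; rewrite cardS fitS valS !eqxx.
Qed.

Definition rat_size (i : item I) : rat := (isize i)%:R.

Lemma total_rat_size (S : {set item I}) :
  total_value rat_size S = (total_size S)%:R.
Proof. by rewrite /total_value -natr_sum. Qed.

Lemma instance_witness Hw Hr :
  bounded I (capD I) Hw -> bounded I (capR I) Hr ->
  (forall n, vertex Hw n -> attains I (capD I) Hw n) ->
  (forall m, vertex Hr m -> attains I (capR I) Hr m) ->
  witness Hw Hr (@value I) rat_size (capR I)%:R (capD I)%:R
    (pick_optimal (capD I) Hw) (pick_optimal (capR I) Hr).
Proof.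
move=> bw br attw attr; split.
- by split=> i; rewrite ?value_ge0 // ltr0n isize_gt0.
- by rewrite ler0n ltr_nat capRD.
- split=> n; [move/attw | move/attr]; case/pick_optimalP => cardS fitS valS;
    by split; rewrite // total_rat_size ler_nat.
- by split=> S; rewrite total_rat_size ler_nat; [apply: bw | apply: br].
Qed.

End InstanceWitness.

Lemma realizable_exchange Hw Hr : realizable Hw Hr -> exchange_closure Hw Hr.
Proof.
case=> I [termw termr hullw hullr].
apply/witness_exchange/(@instance_witness I).
- exact: hull_bounded termw hullw.
- exact: hull_bounded termr hullr.
- by move=> n; apply: hull_attains_vertex.
- by move=> m; apply: hull_attains_vertex.
Qed.

Lemma full_witness_exchange Hw Hr :
  full_witness_closure Hw Hr -> exchange_closure Hw Hr.
Proof.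
case=> E [a [d [R [D [X [Z [_ ge0 RD opt ub]]]]]]].
exact: (@witness_exchange _ _ E a d R D X Z).
Qed.

(** * Terminal count at most two *)

Definition half_bound (Hw Hr : target_seq) : Prop :=
  slope Hw 2 > rho1 Hr -> Hr (last_count Hr) <= 2%:R^-1 * Hw 2%N.

Section TwoCounts.
Variables Hw Hr : target_seq.
Hypothesis bw2 : last_count Hw = 2%N.

Let Hw1_ge : 2%:R^-1 * Hw 2%N <= Hw 1%N.
Proof. by have := @hval_concave Hw 1; rewrite bw2 hval0 => /(_ isT); lra. Qed.

Lemma all_long_half_bound : all_long_bounds Hw Hr -> half_bound Hw Hr.
Proof.
move=> along h2; have v2 : vertex Hw 2 by rewrite -bw2 vertex_last ?bw2.
have [+ _] := along 2%N _ v2 h2 (leqnn _).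
have [-> _|br_gt0] := posnP (last_count Hr).
  by rewrite hval0; have := bar_ge0 Hw 2; rewrite bar_id ?bw2 //; lra.
by rewrite bar_last bw2 //=; lra.
Qed.

Lemma half_bound_all_long :
  dominance Hw Hr -> half_bound Hw Hr -> all_long_bounds Hw Hr.
Proof.
move=> dom half n m vn h_n le_mb.
have := vertex_gt0 vn; have := vertex_le vn; rewrite bw2.
case: n vn h_n => [|[|[|]]] // vn h_n _ _; split=> //.
  by rewrite /= !mul0r !add0r dom.
case: m le_mb => [_ | m le_mb].
  by rewrite hval0 /= bar_id ?bw2 //; move: Hw1_ge; lra.
rewrite [bar _ _]bar_last ?bw2 //=.
have := half h_n; have := bar_le_last Hr m.+1; rewrite bar_id //; lra.
Qed.

(** Both members of the two-element optimal set have value at least the second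
    slope, so beyond [rho1 Hr] they are long; each can then be traded for the
    largest small-capacity set, and the less valuable one gives the bound. *)
Lemma exchange_half_bound : exchange_closure Hw Hr -> half_bound Hw Hr.
Proof.
case=> _ [W [admw _ admwr]] h2.
have [br0 | br_gt0] := posnP (last_count Hr).
  by rewrite br0 hval0; have := bar_ge0 Hw 2; rewrite bar_id ?bw2 //; lra.
have v2 : vertex Hw 2 by rewrite -bw2 vertex_last ?bw2.
have [_ [x_le x_short + _ _]] := admw _ v2.
rewrite !big_ord_recl big_ord0 addr0 => x_sum.
have long_all i : i \in long W 2.
  apply/negPn/negP => /x_short => le_rho.
  have /andP[_ x0_le] := x_le ord0; have /andP[_ x1_le] := x_le (lift ord0 ord0).
  move: h2 le_rho; rewrite /slope /=.
  by case: (unliftP ord0 i) => [j|] ->; rewrite ?ord1; lra.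
have [_ [_ O_short _] ec4 _] := admwr _ _ v2 (vertex_last br_gt0).
have O0 : overlap W 2 (last_count Hr) = set0.
  by apply/setP=> i; rewrite inE; apply/negP => /O_short; rewrite long_all.
have trade (i : 'I_2) : Hr (last_count Hr) <= xval W i.
  have := ec4 i (long_all i).
  rewrite big1 => [|[j jO] _]; last by case: notF; rewrite -(in_set0 j) -O0.
  rewrite O0 cards0 bar_last ?bw2 /= ?subn0 //; lra.
by have := trade ord0; have := trade (lift ord0 ord0); lra.
Qed.

End TwoCounts.

(** * Sharp instances *)

Lemma card_prefix n k : (k <= n)%N -> #|[set i : 'I_n | (i < k)%N]| = k.
Proof.
move=> le_kn; have -> : [set i : 'I_n | (i < k)%N] = widen_ord le_kn @: setT.
  apply/setP=> i; rewrite inE; apply/idP/imsetP => [lt_ik | [j _ ->]] /=.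
    by exists (Ordinal lt_ik); rewrite ?inE //; apply: val_inj.
  exact: ltn_ord.
rewrite card_imset ?cardsT ?card_ord // => i j eq_ij.
by apply: val_inj; move/(congr1 val): eq_ij.
Qed.

(** Remove the largest index [j] of [T]: as [#|T| <= j.+1], its increment is at
    most the last of the first [#|T|] ones. *)
Lemma concave_increments_le f n (T : {set 'I_n}) : concave_seq f ->
  \sum_(j in T) (f j.+1 - f j) <= f #|T| - f 0%N.
Proof.
move=> cf; have [c] := ubnP #|T|.
elim: c => // c IH in T *; rewrite ltnS => le_Tc.
have [-> | [j0 j0T]] := set_0Vmem T; first by rewrite big_set0 cards0 subrr.
have [j /= jT max_j] := arg_maxnP (fun j : 'I_n => val j) j0T.
have cardT : #|T| = #|T :\ j|.+1 by rewrite [LHS](cardsD1 j) (jT : j \in T).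
have le_T : (#|T| <= j.+1)%N.
  rewrite -(card_prefix (ltn_ord j)); apply/subset_leq_card/subsetP => i iT.
  by rewrite inE ltnS max_j.
rewrite (big_setD1 j) //=.
have := IH (T :\ j); rewrite -ltnS -cardT => /(_ le_Tc).
rewrite cardT in le_T *; have := concave_slopes cf (le_T : #|T :\ j| <= j)%N; lra.
Qed.

Lemma sum_prefix_increments f n k : (k <= n)%N ->
  \sum_(j in [set j : 'I_n | (j < k)%N]) (f j.+1 - f j) = f k - f 0%N :> rat.
Proof.
move=> le_kn; rewrite -(telescope_sumr f (leq0n k)) big_mkord.
rewrite (big_ord_widen n (fun j => f j.+1 - f j)) //.
by apply: eq_bigl => j; rewrite inE.
Qed.

Definition sharp_instance (Hw Hr : target_seq) (I : instance) : Prop :=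
  [/\ bounded I (capD I) Hw, bounded I (capR I) Hr,
      forall n, (n <= last_count Hw)%N -> attains I (capD I) Hw n
    & forall m, (m <= last_count Hr)%N -> attains I (capR I) Hr m].

Lemma sharp_realizable Hw Hr I : sharp_instance Hw Hr I -> realizable Hw Hr.
Proof.
case=> bw br attw attr; exists I; split.
- exact: sharp_terminal_count.
- exact: sharp_terminal_count.
- exact: sharp_hull.
- exact: sharp_hull.
Qed.

Lemma sharp_full_witness Hw Hr I : sharp_instance Hw Hr I ->
  (#|item I| <= Nstar Hw Hr)%N -> full_witness_closure Hw Hr.
Proof.
case=> bw br attw attr cardI.
have [||ge0 RD opt ub] := @instance_witness I Hw Hr bw br.
- by move=> n /vertex_le; apply: attw.
- by move=> m /vertex_le; apply: attr.
do 7 eexists; split; [exact: cardI | exact: ge0 | exact: RD | exact: opt | exact: ub].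
Qed.

(** The unit-size items realize [Hr], and all others are long, so as not to
    disturb it. A giant excludes every other item; a big item has the least size
    that is long, so that [D] determines how many unit items fit next to it. *)
Section Layered.
Variables (Hw Hr : target_seq) (g q : nat) (v : rat) (D : nat).
Let b := last_count Hr.
Hypotheses (v_ge0 : 0 <= v) (lt_bD : (b < D)%N).

Definition layered_item := ('I_b + ('I_g + 'I_q))%type.

Definition layered_value (x : layered_item) : rat :=
  match x with
  | inl j => bar Hr j.+1 - bar Hr j
  | inr (inl _) => bar Hw 1
  | inr (inr _) => v
  end.

Definition layered_size (x : layered_item) : nat :=
  match x with inl _ => 1%N | inr (inl _) => D | inr (inr _) => b.+1 end.

Fact layered_value_ge0 x : 0 <= layered_value x.
Proof. by case: x => [j | [j | j]] //=; rewrite ?subr_ge0 ?bar_leS ?bar_ge0. Qed.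

Fact layered_size_gt0 x : (0 < layered_size x)%N.
Proof. by case: x => [j | [j | j]] //=; apply: leq_trans lt_bD. Qed.

Fact layered_size_le x : (layered_size x <= D)%N.
Proof. by case: x => [j | [j | j]] //=; apply: leq_trans lt_bD. Qed.

Definition layered : instance :=
  Instance layered_value_ge0 layered_size_gt0 layered_size_le lt_bD.

Section Parts.
Variable S : {set layered_item}.

Definition shorts : {set 'I_b} := [set j | inl j \in S].
Definition giants : {set 'I_g} := [set j | inr (inl j) \in S].
Definition bigs : {set 'I_q} := [set j | inr (inr j) \in S].

Lemma layered_card : #|S| = (#|shorts| + (#|giants| + #|bigs|))%N.
Proof.
rewrite -!sum1_card big_sumType /= big_sumType /=.
by congr (_ + (_ + _))%N; apply: eq_bigl => j; rewrite inE.
Qed.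

Lemma layered_total_size :
  total_size (S : {set item layered}) =
  (#|shorts| + (#|giants| * D + #|bigs| * b.+1))%N.
Proof.
rewrite /total_size big_sumType /= big_sumType /= -!sum_nat_const sum1_card.
by congr (_ + (_ + _))%N; [apply: eq_card | apply: eq_bigl | apply: eq_bigl];
  move=> j; rewrite !inE.
Qed.

Lemma layered_total_value :
  total_value (@value layered) S =
  \sum_(j in shorts) (bar Hr j.+1 - bar Hr j)
  + (#|giants|%:R * bar Hw 1 + #|bigs|%:R * v).
Proof.
rewrite /total_value big_sumType /= big_sumType /= !mulr_natl -!sumr_const.
by congr (_ + (_ + _)); apply: eq_bigl => j; rewrite inE.
Qed.

Lemma layered_total_value_le :
  total_value (@value layered) S <=
  bar Hr #|shorts| + (#|giants|%:R * bar Hw 1 + #|bigs|%:R * v).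
Proof.
rewrite layered_total_value lerD2r.
have := concave_increments_le shorts (bar_concave Hr).
by rewrite bar0 subr0.
Qed.

End Parts.

Lemma layered_attains c (H : target_seq) n t k l :
  (t <= b)%N -> (k <= g)%N -> (l <= q)%N -> (t + (k + l))%N = n ->
  (t + (k * D + l * b.+1) <= c)%N ->
  bar Hr t + (k%:R * bar Hw 1 + l%:R * v) = H n -> attains layered c H n.
Proof.
move=> le_tb le_kg le_lq def_n fit def_H.
pose S : {set layered_item} := [set x : layered_item | match x with
  | inl j => (val j < t)%N
  | inr (inl j) => (val j < k)%N
  | inr (inr j) => (val j < l)%N
  end].
have S1 : shorts S = [set j : 'I_b | (j < t)%N] by apply/setP=> j; rewrite !inE.
have S2 : giants S = [set j : 'I_g | (j < k)%N] by apply/setP=> j; rewrite !inE.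
have S3 : bigs S = [set j : 'I_q | (j < l)%N] by apply/setP=> j; rewrite !inE.
exists S; split.
- by rewrite layered_card S1 S2 S3 !card_prefix.
- by rewrite layered_total_size S1 S2 S3 !card_prefix.
- rewrite layered_total_value S1 S2 S3 !card_prefix // -def_H; congr (_ + _).
  by rewrite (sum_prefix_increments (bar Hr)) // bar0 subr0.
Qed.

Lemma layered_bounded_small : bounded layered b Hr.
Proof.
move=> S; rewrite layered_total_size => fitS.
have giants0 : #|giants S| = 0%N by nia.
have bigs0 : #|bigs S| = 0%N by nia.
apply: le_trans (layered_total_value_le S) _.
by rewrite layered_card giants0 bigs0 !mul0r !addr0 !addn0.
Qed.

Lemma layered_attains_small m : (m <= b)%N -> attains layered b Hr m.
Proof.
move=> le_mb; apply: (@layered_attains _ _ _ m 0 0);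
  by rewrite ?addn0 ?mul0r ?addr0 ?bar_id.
Qed.

Lemma layered_bounded_large :
  (forall l t, (l <= q)%N -> (t <= b)%N -> (l * b.+1 + t <= D)%N ->
     l%:R * v + Hr t <= bar Hw (l + t)) ->
  bounded layered D Hw.
Proof.
move=> ub S; rewrite layered_total_size => fitS.
apply: le_trans (layered_total_value_le S) _; rewrite layered_card.
have [g0 | g_gt0] := posnP #|giants S|.
  rewrite g0 mul0r !add0r add0n addnC addrC.
  have le_sb : (#|shorts S| <= b)%N by rewrite -[leqRHS]card_ord max_card.
  rewrite bar_id //; apply: ub => //; last by move: fitS; rewrite g0; lia.
  by rewrite -[leqRHS]card_ord max_card.
have -> : #|giants S| = 1%N by nia.
have -> : #|shorts S| = 0%N by nia.
have -> : #|bigs S| = 0%N by nia.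
by rewrite bar0 mul1r mul0r add0r addr0.
Qed.

Lemma layered_sharp :
  (forall l t, (l <= q)%N -> (t <= b)%N -> (l * b.+1 + t <= D)%N ->
     l%:R * v + Hr t <= bar Hw (l + t)) ->
  (forall n, (n <= last_count Hw)%N -> exists t k l,
     [/\ [/\ t <= b, k <= g & l <= q]%N, (t + (k + l))%N = n,
         (t + (k * D + l * b.+1) <= D)%N
       & bar Hr t + (k%:R * bar Hw 1 + l%:R * v) = Hw n]) ->
  sharp_instance Hw Hr layered.
Proof.
move=> ub att; split.
- exact: layered_bounded_large.
- exact: layered_bounded_small.
- move=> n /att[t [k [l [[le_t le_k le_l] def_n fit def_H]]]].
  exact: (layered_attains le_t le_k le_l def_n fit def_H).
- exact: layered_attains_small.
Qed.

End Layered.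

Lemma card_layered Hr g q :
  #|{: layered_item Hr g q}| = (last_count Hr + (g + q))%N.
Proof. by rewrite !card_sum !card_ord. Qed.

Lemma vertex_sum_ge H : (last_count H <=
  \sum_(1 <= m < (last_count H).+1 | vertex H m) m)%N.
Proof.
have [-> // | b_gt0] := posnP (last_count H).
by rewrite big_mkcond big_nat_recr //= vertex_last // leq_addl.
Qed.

(** The giant is present only when 1 is a vertex, because [Nstar] counts an item
    for it only then. If 1 is no vertex and the terminal count is two, then
    [Hw 2 = 2 * Hw 1], and an item worth [Hw 1] is there already: a big one in
    the first layout, and in the second the first unit one, since the condition
    [Hw 2 - Hw 1 <= rho1 Hr] and dominance force [Hr 1 = Hw 1]. *)
Lemma sharp_instance_exists Hw Hr : (last_count Hw <= 2)%N ->
  dominance Hw Hr -> all_long_bounds Hw Hr ->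
  exists2 I, sharp_instance Hw Hr I & (#|item I| <= Nstar Hw Hr)%N.
Proof.
move=> bw_le2 dom along; pose b := last_count Hr; pose g : nat := vertex Hw 1.
pose Ww := (\sum_(1 <= n < (last_count Hw).+1 | vertex Hw n) n)%N.
have layout q (v : rat) D (v_ge0 : 0 <= v) (lt_bD : (b < D)%N) :
    (g + q <= Ww)%N ->
    sharp_instance Hw Hr (@layered Hw Hr g q v D v_ge0 lt_bD) ->
    exists2 I, sharp_instance Hw Hr I & (#|item I| <= Nstar Hw Hr)%N.
  move=> le_gq sharp; exists (@layered Hw Hr g q v D v_ge0 lt_bD) => //.
  by rewrite card_layered addnC leq_add ?vertex_sum_ge.
have [bw1 | bw2] := leqP (last_count Hw) 1.
  have last1 : (0 < last_count Hw)%N -> last_count Hw = 1%N by lia.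
  have g_last : (0 < last_count Hw)%N -> g = 1%N.
    by move=> bw_gt0; have := vertex_last bw_gt0; rewrite last1 // /g => ->.
  apply: (layout 0%N 0 b.+1 (lexx 0) (ltnSn b)).
    rewrite addn0; apply: leq_trans (vertex_sum_ge Hw).
    by rewrite /g; case v1: (vertex Hw 1); rewrite //= (vertex_le v1).
  apply: layered_sharp => [l t | n le_n].
    by rewrite leqn0 => /eqP-> le_tb _; rewrite mul0r !add0r dom.
  case: n le_n => [_ | n le_n].
    by exists 0%N, 0%N, 0%N; split; rewrite ?bar0 ?hval0 ?mul0r ?addr0.
  have bw_gt0 : (0 < last_count Hw)%N by lia.
  have -> : n = 0%N by lia.
  exists 0%N, 1%N, 0%N; split; rewrite ?g_last //; try lia.
  by rewrite bar0 bar_id // mul1r mul0r add0r addr0.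
have {bw_le2} bw2 : last_count Hw = 2%N by lia.
have def_W : Ww = (g + 2)%N.
  rewrite /Ww bw2 big_mkcond big_nat_recr //= big_nat1 -[in vertex Hw 2]bw2.
  by rewrite vertex_last ?bw2 // /g; case: (vertex _ _).
have Hw2_gt0 : 0 < Hw 2%N - Hw 1%N by rewrite subr_gt0 hval_incr ?bw2.
have slopes := @hval_concave Hw 1; rewrite bw2 hval0 subr0 in slopes.
have {}slopes := slopes isT.
have Hw1E : bar Hw 1 = Hw 1%N by rewrite bar_id ?bw2.
have Hw2E k : bar Hw k.+2 = Hw 2%N by rewrite bar_last bw2.
have [h2 | h2] := ltP (rho1 Hr) (slope Hw 2).
  (* Two big items of half the value, which fill the large capacity. *)
  have half := all_long_half_bound bw2 along h2.
  have Hr_le t : (t <= b)%N -> Hr t <= 2%:R^-1 * Hw 2%N.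
    by move=> le_tb; rewrite -(bar_id le_tb); apply: le_trans (bar_le_last _ _) half.
  have v_ge0 : 0 <= 2%:R^-1 * Hw 2%N by lra.
  have lt_bD : (b < 2 * b.+1)%N by lia.
  apply: (layout 2%N _ _ v_ge0 lt_bD); first by rewrite def_W.
  apply: layered_sharp => [l t le_l le_tb fit | n].
    case: l le_l fit => [|[|[|l]]] // _ fit.
    - by rewrite mul0r !add0r dom.
    - case: t le_tb fit => [|t] le_tb _; first by rewrite hval0 addn0 Hw1E; lra.
      by have := Hr_le _ le_tb; rewrite Hw2E; lra.
    - have -> : t = 0%N by lia.
      by rewrite hval0 Hw2E; lra.
  rewrite bw2; case: n => [|[|[|n]]] // _.
  - by exists 0%N, 0%N, 0%N; split; rewrite ?bar0 ?hval0 ?mul0r ?addr0.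
  - case v1: (vertex Hw 1).
      exists 0%N, 1%N, 0%N; split; rewrite /g ?v1 //; try lia.
      by rewrite bar0 Hw1E; lra.
    exists 0%N, 0%N, 1%N; split; rewrite //; try lia.
    have := nonvertex_affine (k := 0) _ (negbT v1); rewrite bw2 hval0 bar0.
    by move=> /(_ isT); lra.
  - exists 0%N, 0%N, 2%N; split; rewrite //; try lia.
    by rewrite bar0; lra.
(* One big item, with room for a single unit item next to it. *)
rewrite /slope /= in h2.
have b_gt0 : (0 < b)%N.
  by rewrite lt0n; apply/negP => b0; move: h2; rewrite /rho1 b0; lra.
have rhoE : rho1 Hr = Hr 1%N by rewrite -bar1 bar_id.
have rho_le : Hr 1%N <= Hw 1%N by rewrite -Hw1E dom.
rewrite {}rhoE in h2.
have v_ge0 : 0 <= Hw 2%N - Hr 1%N by lra.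
apply: (layout 1%N _ _ v_ge0 (leqnSn b.+1)); first by rewrite def_W leq_add2l.
apply: layered_sharp => [l t le_l le_tb fit | n].
  case: l le_l fit => [|[|l]] // _ fit; first by rewrite mul0r !add0r dom.
  have : (t <= 1)%N by move: fit; rewrite mul1n; lia.
  case: t {le_tb fit} => [|[|t]] // _; first by rewrite hval0 addn0 Hw1E; lra.
  by rewrite Hw2E; lra.
rewrite bw2; case: n => [|[|[|n]]] // _.
- by exists 0%N, 0%N, 0%N; split; rewrite ?bar0 ?hval0 ?mul0r ?addr0.
- case v1: (vertex Hw 1).
    exists 0%N, 1%N, 0%N; split; rewrite /g ?v1 //; try lia.
    by rewrite bar0 Hw1E; lra.
  exists 1%N, 0%N, 0%N; split; rewrite //; try lia.
  have := nonvertex_affine (k := 0) _ (negbT v1); rewrite bw2 hval0 bar_id //.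
  by move=> /(_ isT); lra.
- exists 1%N, 0%N, 1%N; split; rewrite //; try lia.
  by rewrite bar_id //; lra.
Qed.

Theorem theorem4p1 (Hw Hr : target_seq) (hb : (last_count Hw <= 2)%N) :
  [/\ linear_closure Hw Hr <-> exchange_closure Hw Hr,
      exchange_closure Hw Hr <-> full_witness_closure Hw Hr,
      realizable Hw Hr <-> dominance Hw Hr /\ all_long_bounds Hw Hr
    & last_count Hw = 2%N ->
      (realizable Hw Hr <->
       dominance Hw Hr /\
       (slope Hw 2 > rho1 Hr -> Hr (last_count Hr) <= 2%:R^-1 * Hw 2%N))].
Proof.
pose bounds := dominance Hw Hr /\ all_long_bounds Hw Hr.
have linear_bounds : linear_closure Hw Hr <-> bounds.
  split=> [[dom along _] | [dom along]]; first by split.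
  split=> // n m vn n_ge3.
  by have := leq_trans n_ge3 (leq_trans (vertex_le vn) hb).
have exchange_bounds : exchange_closure Hw Hr -> bounds.
  move=> ec; have [dom _] := ec; split=> //.
  have [bw2 | bw_ne2] := eqVneq (last_count Hw) 2%N.
    exact: half_bound_all_long bw2 dom (exchange_half_bound bw2 ec).
  move=> n m vn _ le_m; have -> : n = 1%N.
    by have := vertex_gt0 vn; have := vertex_le vn; lia.
  by rewrite /= !mul0r !add0r; split=> //; apply: dom.
have bounds_witness : bounds -> full_witness_closure Hw Hr.
  by case=> dom /(sharp_instance_exists hb dom)[I]; apply: sharp_full_witness.
have bounds_realizable : bounds -> realizable Hw Hr.
  case=> dom /(sharp_instance_exists hb dom)[I sharp _].
  exact: sharp_realizable sharp.
have realizable_bounds : realizable Hw Hr <-> bounds.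
  by split=> // /realizable_exchange/exchange_bounds.
split.
- split=> [/linear_bounds/bounds_witness/full_witness_exchange // |].
  by move/exchange_bounds/linear_bounds.
- by split=> [/exchange_bounds/bounds_witness | /full_witness_exchange].
- exact: realizable_bounds.
- move=> bw2; apply: (iff_trans realizable_bounds); split=> -[dom h]; split=> //.
    exact: all_long_half_bound.
  exact: half_bound_all_long.
Qed.
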